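(* Let $\psi\in L^\infty(\mathbb{Z})$ vanish on the negative integers, write $a_n=\psi(n)$ for $n\ge0$, and let $\alpha\in\mathbb{C}$. Let $\hat\psi$ be the function on the unit disc $\mathbb{D}=\{z\in\mathbb{C}:|z|<1\}$ defined by $$\hat\psi(z)=\sum_{n=0}^\infty a_nz^n .$$ If $\hat\psi(z)-\frac{\alpha}{1-z}$ has $H^1$ boundary behavior at $z=1$, then $\psi$ is one-sidedly almost convergent to $\alpha$, that is, $$\lim_{k\to\infty}\frac1k\sum_{i=0}^{k-1}\psi(n+i)=\alpha$$ uniformly in $n\ge0$.
   Context: A function $f$ on $\mathbb{D}$ has $H^1$ boundary behavior at $z_0=e^{it_0}$ if there exist $\delta>0$ and a function $F(e^{it})$ in $L^1(t_0-\delta,t_0+\delta)$ such that $f(re^{it})$ converges to $F(e^{it})$ in $L^1(t_0-\delta,t_0+\delta)$ as $r\to1^-$. $L^\infty(\mathbb{Z})$ is the space of bounded complex-valued functions on $\mathbb{Z}$, and $(f*\psi)(n)=\sum_{k\in\mathbb{Z}}f(k)\psi(n-k)$. A mean on $L^\infty(\mathbb{Z})$ is $\varphi\in L^\infty(\mathbb{Z})^*$ with $\varphi(\psi)\ge0$ for all $\psi\ge0$ and $\varphi(\mathbf1)=1$; it is topologically invariant if $\varphi(f*\psi)=\varphi(\psi)$ for all $\psi\in L^\infty(\mathbb{Z})$ and all nonnegative $f\in L^1(\mathbb{Z})$ with $\sum_k f(k)=1$. $\mathcal{T}_+$ is the set of topologically invariant means on $L^\infty(\mathbb{Z})$ that vanish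 on every $\phi\in L^\infty(\mathbb{Z})$ with $\lim_{n\to+\infty}\phi(n)=0$. A function $\psi\in L^\infty(\mathbb{Z})$ is one-sidedly almost convergent to $\alpha$ if $\varphi(\psi)=\alpha$ for every $\varphi\in\mathcal{T}_+$. *)

(* Defs.v *)
From HB Require Import structures.
From mathcomp Require Import all_boot all_order all_algebra.
From mathcomp Require Import complex.
From mathcomp Require Import all_classical all_reals all_analysis.

Set Implicit Arguments.
Unset Strict Implicit.
Unset Printing Implicit Defensive.

Import Order.TTheory GRing.Theory Num.Theory.
Import numFieldNormedType.Exports.
Import Normc.

Local Open Scope classical_set_scope.
Local Open Scope ring_scope.

Section Linf.
Variable R : realType.
Local Notation C := (R[i]).

Lemma normC_normc (z : C) : `|z| = (normc z)%:C%C.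
Proof. by []. Qed.

Lemma normc_ge0 (z : C) : 0 <= normc z.
Proof. by case: z => a b; exact: sqrtr_ge0. Qed.

Lemma ler_normcD (x y : C) : normc (x + y) <= normc x + normc y.
Proof. by have := ler_normD x y; rewrite !normC_normc -rmorphD lecR. Qed.

(* R[i]^o is R[i] seen as a normed module over itself: the library puts the
   topology of a numFieldType on this alias only. *)
Definition bddZ : {pred int -> C^o} :=
  fun f => `[< bounded_fun (f : int -> C^o) >].

Lemma bddZP (f : int -> C^o) :
  reflect (exists M : R, forall n, normc (f n) <= M) (f \in bddZ).
Proof.
rewrite unfold_in; apply: (iffP (asboolP _)).
  move=> /pinfty_ex_gt0 [M M0 fM]; exists (complex.Re M) => n.
  have := fM n Logic.I; rewrite /= normC_normc.
  by case: M {M0 fM} => a b; rewrite lecE => /andP[_].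
move=> [M fM]; exists M%:C%C; split; first by rewrite complex_real.
move=> N MN n _ /=; rewrite (le_trans _ (ltW MN))//.
by rewrite (normC_normc (f n)) lecR.
Qed.

Lemma bddZ_submod_closed : submod_closed bddZ.
Proof.
split.
  by apply/bddZP; exists 0 => n; rewrite normc0.
move=> a f g /bddZP[M fM] /bddZP[N gN]; apply/bddZP.
exists (normc a * M + N) => n.
rewrite (le_trans (ler_normcD _ _))// lerD//.
by rewrite [X in normc X](_ : _ = a * f n)// normcM ler_wpM2l ?normc_ge0.
Qed.

HB.instance Definition _ := GRing.isSubmodClosed.Build _ _ bddZ
  bddZ_submod_closed.

Record Linf := MkLinf { Linf_fun :> int -> C^o; Linf_funP : Linf_fun \in bddZ }.

HB.instance Definition _ := [isSub for Linf_fun].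
HB.instance Definition _ := [Choice of Linf by <:].
HB.instance Definition _ := [SubChoice_isSubLmodule of Linf by <:].

(* The norm of a normed module over R[i] takes its values in R[i]. *)
Definition Linf_norm (f : Linf) : C :=
  (sup (range (fun n => normc (f n))))%:C%C.

Lemma Linf_has_sup (f : Linf) : has_sup (range (fun n => normc (f n))).
Proof.
split; first by exists (normc (f 0)), 0.
by have /bddZP[M fM] := Linf_funP f; exists M => _ [n _ <-].
Qed.

Lemma normc_le_Linf (f : Linf) n :
  normc (f n) <= sup (range (fun n => normc (f n))).
Proof. by apply: ub_le_sup; [case: (Linf_has_sup f)|exists n]. Qed.

Lemma Linf_normD f g : Linf_norm (f + g) <= Linf_norm f + Linf_norm g.
Proof.
rewrite -rmorphD lecR; apply: ge_sup; first by case: (Linf_has_sup (f + g)).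
move=> _ [n _ <-]; rewrite (le_trans (ler_normcD _ _))//.
by rewrite lerD// normc_le_Linf.
Qed.

Lemma Linf_normZ (a : C) f : Linf_norm (a *: f) = `|a| * Linf_norm f.
Proof.
have h (b : C) (g : Linf) : sup (range (fun n => normc ((b *: g) n))) <=
    normc b * sup (range (fun n => normc (g n))).
  apply: ge_sup; first by case: (Linf_has_sup (b *: g)).
  move=> _ [n _ <-]; rewrite [X in normc X](_ : _ = b * g n)// normcM.
  by rewrite ler_wpM2l ?normc_ge0// normc_le_Linf.
rewrite normC_normc -rmorphM; congr (_%:C%C); apply/eqP.
rewrite eq_le h/=; have [->|a0] := eqVneq a 0.
  rewrite normc0 mul0r; by apply: (le_trans _ (normc_le_Linf (0 *: f) 0)); exact: normc_ge0.
have na0 : 0 < normc a.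
  rewrite lt_neqAle normc_ge0 andbT eq_sym.
  by apply: contra a0 => /eqP/eq0_normc ->.
rewrite -ler_pdivlMl// -normcV.
by have := h a^-1 (a *: f); rewrite scalerA mulVf// scale1r.
Qed.

Lemma Linf_norm0_eq0 f : Linf_norm f = 0 -> f = 0.
Proof.
move=> /complexI f0; apply/val_inj/funext => n; apply/eq0_normc/le_anti.
by rewrite normc_ge0 andbT -f0 normc_le_Linf.
Qed.

HB.instance Definition _ := @Lmodule_isNormed.Build C Linf Linf_norm
  Linf_normD Linf_normZ Linf_norm0_eq0.

End Linf.

Section L1_convolution.
Variable R : realType.
Local Notation C := (R[i]).

Record L1Z := MkL1Z {
  L1Z_fun :> int -> C;
  L1ZP : summable [set: int] (fun k => (normc (L1Z_fun k))%:E) }.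

(* \sum_(k in Z) f k, as the sum over k >= 0 plus the sum over k < 0
   (recall that Negz k is - (k + 1)). *)
Definition sumZ (f : int -> C) : C :=
  limn (series (fun k : nat => f (Posz k)) : (C^o)^nat) +
  limn (series (fun k : nat => f (Negz k)) : (C^o)^nat).

Definition convZ (f psi : int -> C) (n : int) : C :=
  sumZ (fun k => f k * psi (n - k)).

Lemma normc_limn_le (u : (C^o)^nat) (M : R) : (forall n, normc (u n) <= M) ->
  normc (limn u) <= Num.max (M + 1) (normc (point : C^o)).
Proof.
move=> uM; have [cu|/dvgP->] := pselect (cvgn u); last first.
  by rewrite le_max lexx orbT.
rewrite le_max; apply/orP; left.
have [N _ /(_ N (leqnn N))/= uN] := (@cvgrPdist_lt _ _ _ _ _ _ _).1 cu 1 ltr01.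
rewrite -[limn u](subrK (u N)) (le_trans (ler_normcD _ _))// addrC lerD//.
by rewrite -lecR -normC_normc ltW.
Qed.

Lemma L1Z_partial_sum (f : L1Z) (g : nat -> int) N : injective g ->
  \sum_(k < N) normc (f (g k)) <=
  fine (\esum_(k in [set: int]) `|(normc (f k))%:E|)%E.
Proof.
move=> ginj; rewrite -lee_fin fineK; last by rewrite -summableE; exact: L1ZP.
apply: esum_ge; exists (g @` `I_N).
  by split=> //; exact: finite_image.
rewrite fsbig_image; last by move=> ? ? _ _ /ginj.
rewrite -fsbig_ord -sumEFin lee_sum// => i _.
by rewrite lee_fin ler_norm.
Qed.

Lemma convZ_bounded (f : L1Z) (psi : Linf R) : convZ f psi \in @bddZ R.
Proof.
have /bddZP[M psiM] := Linf_funP psi.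
have M0 : 0 <= M by rewrite (le_trans _ (psiM 0))// normc_ge0.
pose S := fine (\esum_(k in [set: int]) `|(normc (f k))%:E|)%E.
have H n (g : nat -> int) : injective g -> forall N,
    normc (series (fun k => f (g k) * psi (n - g k)) N) <= S * M.
  move=> ginj N; rewrite /series/= big_mkord.
  have -> : S * M = M * S by rewrite mulrC.
  apply: le_trans (ler_wpM2l M0 (L1Z_partial_sum f N ginj)).
  rewrite mulr_sumr; elim/big_ind2 : _ => [|x a y b xa yb|k _].
  - by rewrite normc0.
  - by rewrite (le_trans (ler_normcD _ _))// lerD.
  - by rewrite normcM mulrC ler_wpM2r ?normc_ge0.
apply/bddZP; pose K := Num.max (S * M + 1) (normc (point : C^o)).
exists (K + K) => n; rewrite (le_trans (ler_normcD _ _))//.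
by apply: lerD; apply: normc_limn_le; apply: H => i j [].
Qed.

Definition convL (f : L1Z) (psi : Linf R) : Linf R :=
  MkLinf (convZ_bounded f psi).

End L1_convolution.

Section means.
Variable R : realType.
Local Notation C := (R[i]).
Implicit Types (phi : {linear Linf R -> C^o}) (psi : Linf R).

Lemma cst1_bounded : (fun=> 1) \in @bddZ R.
Proof. by apply/bddZP; exists 1 => n; rewrite normc1. Qed.

Definition Linf1 : Linf R := MkLinf cst1_bounded.

(* The order on C is the partial order for which 0 <= z means that z is real
   and nonnegative. *)
Definition mean phi : Prop :=
  [/\ continuous phi,
      forall psi, (forall n, 0 <= (psi n : C)) -> 0 <= (phi psi : C)
    & phi Linf1 = 1].

Definition topologically_invariant phi : Prop :=
  forall (f : L1Z R) psi,
    (forall k, 0 <= f k) -> sumZ f = 1 -> phi (convL f psi) = phi psi.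

Definition Tplus : set {linear Linf R -> C^o} :=
  [set phi | [/\ mean phi, topologically_invariant phi
    & forall psi, psi (Posz n) @[n --> \oo] --> (0 : C^o) -> phi psi = 0]].

Definition onesided_almost_convergent psi (alpha : C) : Prop :=
  forall phi, Tplus phi -> phi psi = alpha.

End means.

Section H1_boundary_behavior.
Variable R : realType.
Local Notation C := (R[i]).
Local Notation mu := (@lebesgue_measure R).

Definition expi (t : R) : C := (cos t +i* sin t)%C.

Definition cintegrable (A : set R) (f : R -> C) : Prop :=
  mu.-integrable A (fun t => (complex.Re (f t))%:E) /\
  mu.-integrable A (fun t => (complex.Im (f t))%:E).

(* Only the values of f on the open unit disc matter, since r tends to 1 from
   the left. The argument t0 of z0 is determined up to a multiple of 2 pi, and
   the choice is irrelevant since f and F are functions of the point e^(it). *)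
Definition H1_boundary (f : C -> C) (z0 : C) : Prop :=
  exists t0 delta : R, exists F : C -> C,
    let I := `]t0 - delta, t0 + delta[%classic in
    [/\ z0 = expi t0, 0 < delta,
        cintegrable I (fun t => F (expi t)),
        \forall r \near 1^'-, cintegrable I (fun t => f (r%:C%C * expi t))
      & (\int[mu]_(t in I)
          (normc (f (r%:C%C * expi t) - F (expi t)))%:E)%E @[r --> 1^'-]
          --> 0%E].

End H1_boundary_behavior.

Definition hatZ (R : realType) (psi : Linf R) (z : R[i]) : R[i] :=
  limn (series (fun n : nat => (psi (Posz n) : R[i]) * z ^+ n) : (R[i]^o)^nat).

(* Main.v *)
Require Import Defs.
From mathcomp Require Import all_boot all_order all_algebra.
From mathcomp Require Import complex.
From mathcomp Require Import all_classical all_reals all_analysis.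
From mathcomp Require Import measurable_realfun.
From mathcomp Require Import ring lra zify.

Import Order.TTheory GRing.Theory Num.Theory.
Import numFieldNormedType.Exports.
Import Normc.

Local Open Scope classical_set_scope.
Local Open Scope ring_scope.

(** Put b_j = psi(j) - alpha. The function g(z) = hatZ psi z - alpha / (1 - z)
    is the sum of the b_j z^j on the disc, and the theorem says that the means of
    the b_j over the windows [n, n + k) tend to 0 as k grows, uniformly in n.

    Multiplying g on the circle of radius s by a tent function supported in a
    small interval around t0 and taking the Fourier coefficient of index m
    smooths the sequence (b_j s^j) by an even kernel c:
      V_s(m) = sum_j c_|j - m| b_j s^j.
    The c_m are the Fourier coefficients of the tent. They are nonnegative
    and O(1/m^2), so their total mass S is finite and positive.

    Two facts give the result. First, smoothing changes the sum over a window
    only near its two ends: the sum of V_s over [n, n + k) differs from S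
    times the sum of b_j s^j by at most a constant times the partial sum of k
    tails of the kernel, which is o(k) by Cesaro (smoothing_defect). Secondly,
    V_s - V_r is at most 4 times the L^1 distance of g(s e^it) and g(r e^it)
    on the interval, uniformly in m (local_smoothing_le), and L^1 convergence
    makes it small for all r, s close to 1. With r fixed, V_r is summable, so
    its window sums are bounded (smoothing_sum_le). Hence the window sums of
    b_j s^j are o(k) uniformly in n and s, and s tends to 1 in each finite sum.
    Comparing with a fixed r < 1 in this way takes the place of the
    Riemann-Lebesgue lemma for the boundary function F.

    For a mean in Tplus, convolution with the unit mass at -1 is the shift,
    so the mean takes the same value at psi and at all its window averages;
    these are uniformly close to alpha on the nonnegative integers, and the
    mean does not see the negative ones (Tplus_uniform_average). *)

Set Implicit Arguments.
Unset Strict Implicit.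
Unset Printing Implicit Defensive.

(** * Complex modulus *)

Lemma normcX (R : realType) (z : R[i]) n : normc (z ^+ n) = normc z ^+ n.
Proof. by elim: n => [|n IH]; rewrite ?normc1// !exprS normcM IH. Qed.

Lemma normc_real (R : realType) (x : R) : normc (x%:C%C) = `|x|.
Proof. by rewrite /normc/= expr0n/= addr0 sqrtr_sqr. Qed.

Lemma normcB (R : realType) (x y : R[i]) : normc (x - y) <= normc x + normc y.
Proof. by rewrite (le_trans (ler_normcD _ _))// (normcN (y : Rcomplex R)). Qed.

Lemma ler_normc_sum (R : realType) (I : Type) (r : seq I) (P : pred I)
    (F : I -> R[i]) :
  normc (\sum_(i <- r | P i) F i) <= \sum_(i <- r | P i) normc (F i).
Proof.
elim/big_ind2 : _ => [|x a y b xa yb|//]; first by rewrite normc0.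
by rewrite (le_trans (ler_normcD _ _))// lerD.
Qed.

Lemma ler_normc_Re (R : realType) (z : R[i]) : `|complex.Re z| <= normc z.
Proof. by rewrite -lecR -normC_normc normc_ge_Re. Qed.

Lemma normc_le_ReIm (R : realType) (z : R[i]) :
  normc z <= `|complex.Re z| + `|complex.Im z|.
Proof.
rewrite [z in normc z]complexE (le_trans (ler_normcD _ _))// lerD//.
  by rewrite normc_real.
rewrite normcM normc_real -[leRHS]mul1r ler_wpM2r//.
by rewrite /normc/= expr0n/= add0r expr1n sqrtr1.
Qed.

Lemma ReM_complex (R : realType) (x y : R[i]) :
  complex.Re (x * y) = complex.Re x * complex.Re y - complex.Im x * complex.Im y.
Proof. by case: x => a b; case: y. Qed.

Lemma ImM_complex (R : realType) (x y : R[i]) :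
  complex.Im (x * y) = complex.Re x * complex.Im y + complex.Im x * complex.Re y.
Proof. by case: x => a b; case: y => c d /=; rewrite addrC. Qed.

Lemma normc_expi (R : realType) (t : R) : normc (expi t) = 1.
Proof. by rewrite /normc/= cos2Dsin2 sqrtr1. Qed.

Lemma expiD (R : realType) (s t : R) : expi (s + t) = expi s * expi t.
Proof. by rewrite /expi cosD sinD; congr (_ +i* _)%C; rewrite addrC. Qed.

Lemma expiX (R : realType) (t : R) n : expi t ^+ n = expi (n%:R * t).
Proof.
elim: n => [|n IH]; first by rewrite mul0r /expi cos0 sin0.
by rewrite exprS IH -expiD -natr1; congr expi; ring.
Qed.

(** * Smoothing with an even summable kernel *)

(** The kernel centred at [m], summed over a window around [m], is a left and a
    right partial sum of [c] that share the central term. *)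
Lemma sum_dist_kernel (R : realType) (c : nat -> R) (n m N : nat) :
  (n <= m)%N -> (m < N)%N ->
  \sum_(n <= j < N) c `|Posz j - Posz m|%N =
  series c (m.+1 - n)%N + series c (N - m)%N - c 0%N.
Proof.
move=> nm mN.
have right : \sum_(m <= j < N) c `|Posz j - Posz m|%N = series c (N - m)%N.
  rewrite -[m in LHS]add0n big_addn /series/=; apply: eq_bigr => i _.
  by congr c; lia.
have left : \sum_(n <= j < m.+1) c `|Posz j - Posz m|%N = series c (m.+1 - n)%N.
  rewrite big_nat_rev/= -[n in LHS]add0n big_addn /series/=.
  rewrite !big_nat; apply: eq_bigr => i /= im; congr c; lia.
rewrite -left -right (big_cat_nat nm (ltnW mN))/= [in RHS]big_nat_recr//=.
by rewrite subrr absz0; ring.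
Qed.

Section kernel.
Context (R : realType) (c : nat -> R) (A : R).
Hypotheses (c_ge0 : forall m, 0 <= c m) (cA : forall N, series c N <= A).
Let tail N := A - series c N.

(** [2 * A - c 0] plays the role of the mass of the two-sided kernel. *)
Lemma sum_dist_kernel_le n N j :
  \sum_(n <= m < N) c `|Posz j - Posz m|%N <= 2 * A - c 0%N.
Proof.
have h a b : 0 <= \sum_(a <= m < b) c `|Posz j - Posz m|%N.
  by apply: sumr_ge0.
have distC m : `|Posz j - Posz m|%N = `|Posz m - Posz j|%N by lia.
apply: (@le_trans _ _ (\sum_(0 <= m < n + N + j.+1) c `|Posz j - Posz m|%N)).
  have [nN|nN] := leqP n N; last by rewrite (big_geq (ltnW nN)).
  rewrite (@big_cat_nat _ _ _ n 0 (n + N + j.+1))/=; [|lia..].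
  rewrite (@big_cat_nat _ _ _ N n (n + N + j.+1))/=; [|lia..].
  by have := h 0%N n; have := h N (n + N + j.+1)%N; lra.
under eq_bigr do rewrite distC.
rewrite sum_dist_kernel//; last by lia.
by have := cA (j.+1 - 0)%N; have := cA (n + N + j.+1 - j)%N; lra.
Qed.

(** Mass of the kernel crosses the ends of the window only. A point of the window
    at distance [i] from an end loses or receives at most [tail i.+1] through
    that end, and there are two ends and two directions: hence the factor 4. *)
Lemma smoothing_defect (d : nat -> R[i]) (M : R) (n k J : nat) :
  (forall j, normc (d j) <= M) -> (n + k <= J)%N ->
  normc ((2 * A - c 0%N)%:C%C * \sum_(n <= j < n + k) d j
    - \sum_(n <= m < n + k) \sum_(0 <= j < J)
        (c `|Posz j - Posz m|%N)%:C%C * d j)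
  <= 4 * M * \sum_(0 <= i < k) tail i.+1.
Proof.
move=> dM nkJ; pose I j m := c `|Posz j - Posz m|%N.
have IC j m : I j m = I m j by rewrite /I; congr c; lia.
have M0 : 0 <= M by apply: le_trans (dM 0%N); exact: normc_ge0.
(* E bounds the mass that the kernel centred at m puts outside of the window *)
pose E m := tail (m.+1 - n) + tail (n + k - m).
have inE m : (n <= m < n + k)%N ->
    2 * A - c 0%N - \sum_(n <= j < n + k) I j m = E m.
  by move=> /andP[nm mk]; rewrite /I sum_dist_kernel// /E /tail; ring.
have outE m : (n <= m < n + k)%N ->
    \sum_(0 <= j < n) I j m + \sum_(n + k <= j < J) I j m <= E m.
  move=> mnk; rewrite -inE//.
  suff : \sum_(0 <= j < J) I j m <= 2 * A - c 0%N.
    rewrite (@big_cat_nat _ _ _ n 0 J)/=; [|lia..].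
    rewrite (@big_cat_nat _ _ _ (n + k) n J)/=; [|lia..].
    lra.
  under eq_bigr do rewrite IC.
  exact: sum_dist_kernel_le.
have sumE : \sum_(n <= m < n + k) E m = 2 * \sum_(0 <= i < k) tail i.+1.
  rewrite /E big_split/= mulr_natl mulr2n; congr (_ + _).
    rewrite -[n in LHS]add0n big_addn addKn add0n; apply: eq_bigr => i _.
    by congr tail; lia.
  rewrite big_nat_rev/= -[n in LHS]add0n big_addn addKn !big_nat.
  by apply: eq_bigr => i /= ik; congr tail; lia.
have -> : \sum_(n <= m < n + k) \sum_(0 <= j < J) (I j m)%:C%C * d j =
    \sum_(0 <= j < J) (\sum_(n <= m < n + k) I j m)%:C%C * d j.
  rewrite exchange_big; apply: eq_bigr => j _.
  by rewrite rmorph_sum mulr_suml.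
pose W j := \sum_(n <= m < n + k) I j m.
have W0 j : 0 <= W j by apply: sumr_ge0 => *; exact: c_ge0.
rewrite (@big_cat_nat _ _ _ n 0 J)/=; [|lia..].
rewrite (@big_cat_nat _ _ _ (n + k) n J)/=; [|lia..].
rewrite -/W.
have bnd a b (w : nat -> R) : (forall j, (a <= j < b)%N -> 0 <= w j) ->
    normc (\sum_(a <= j < b) (w j)%:C%C * d j) <= M * \sum_(a <= j < b) w j.
  move=> w0; apply: (le_trans (ler_normc_sum _ _ _)).
  rewrite mulr_sumr !big_nat; apply: ler_sum => j jab.
  by rewrite normcM normc_real ger0_norm ?w0// mulrC ler_wpM2r ?w0.
set S := 2 * A - c 0%N.
have -> : forall x y z : R[i], S%:C%C * (\sum_(n <= j < n + k) d j) - (x + (y + z)) =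
   (S%:C%C * (\sum_(n <= j < n + k) d j) - y) - (x + z).
  by move=> *; ring.
have -> : S%:C%C * (\sum_(n <= j < n + k) d j) -
    \sum_(n <= j < n + k) (W j)%:C%C * d j =
    \sum_(n <= j < n + k) (S - W j)%:C%C * d j.
  rewrite mulr_sumr -sumrB; apply: eq_bigr => j _.
  by rewrite -mulrBl -rmorphB.
apply: (@le_trans _ _ (M * \sum_(n <= j < n + k) (S - W j) +
   (M * \sum_(0 <= j < n) W j + M * \sum_(n + k <= j < J) W j))).
  apply: (le_trans (normcB _ _)); apply: lerD; last first.
    by apply: (le_trans (ler_normcD _ _)); apply: lerD; apply: bnd => j _; exact: W0.
  apply: bnd => j jk; rewrite subr_ge0.
  exact: sum_dist_kernel_le.

rewrite -!mulrDr -mulrA mulrCA ler_wpM2l//.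
have -> : \sum_(n <= j < n + k) (S - W j) = \sum_(n <= m < n + k) E m.
  rewrite !big_nat; apply: eq_bigr => j jk; rewrite -inE//; congr (_ - _).
  by apply: eq_bigr => i _; exact: IC.
have : \sum_(0 <= j < n) W j + \sum_(n + k <= j < J) W j <=
    \sum_(n <= m < n + k) E m.
  rewrite /W exchange_big/= [X in _ + X]exchange_big/= -big_split/=.
  by rewrite !big_nat; apply: ler_sum => m mk; exact: outE.
by rewrite sumE; lra.
Qed.

(** For an absolutely summable sequence the smoothed window sums stay bounded
    as the window grows. *)
Lemma smoothing_sum_le (d : nat -> R[i]) (n k J : nat) :
  normc (\sum_(n <= m < n + k) \sum_(0 <= j < J)
           (c `|Posz j - Posz m|%N)%:C%C * d j)
  <= (2 * A - c 0%N) * \sum_(0 <= j < J) normc (d j).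
Proof.
rewrite exchange_big/=; apply: (le_trans (ler_normc_sum _ _ _)).
rewrite mulr_sumr; apply: ler_sum => j _.
rewrite -mulr_suml -rmorph_sum/= normcM normc_real.
rewrite ler_wpM2r ?normc_ge0// ger0_norm ?sumr_ge0//.
exact: sum_dist_kernel_le.
Qed.

End kernel.

(** * Fourier coefficients of the tent function *)

(** The integral of [(1 - |t| / delta) cos (p t)] over [[-delta, delta]]: the
    Fourier transform of the tent function of height 1, a Fejer kernel. *)
Definition tent (R : realType) (delta p : R) : R :=
  if p == 0 then delta else 2 * (1 - cos (p * delta)) / (delta * p ^+ 2).

Lemma tent_ge0 (R : realType) (delta p : R) : 0 < delta -> 0 <= tent delta p.
Proof.
move=> d0; rewrite /tent; case: ifPn => [_|p0]; first exact: ltW.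
by apply: divr_ge0; apply: mulr_ge0; rewrite ?subr_ge0 ?cos_le1 ?sqr_ge0//; exact: ltW.
Qed.

Lemma tentN (R : realType) (delta p : R) : tent delta (- p) = tent delta p.
Proof. by rewrite /tent oppr_eq0 mulNr cosN sqrrN. Qed.

Lemma Rintegral_derivative (R : realType) (F f : R -> R) (a b : R) :
  a < b -> (forall x : R, is_derive x 1 F (f x)) -> continuous f ->
  \int[lebesgue_measure]_(x in `[a, b]) f x = F b - F a.
Proof.
move=> ab dF cf; rewrite /Rintegral.
have cF : continuous F.
  move=> x; apply: differentiable_continuous; apply/derivable1_diffP.
  by case: (dF x).
rewrite (@continuous_FTC2 _ f F a b ab)//.
- exact: continuous_subspaceT.
- split.
  + by move=> x _; case: (dF x).
  + by apply: cvg_at_right_filter; exact: cF.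
  + by apply: cvg_at_left_filter; exact: cF.
- by move=> x _; rewrite derive1E; case: (dF x).
Qed.

Section tent_integral.
Context (R : realType) (t0 delta : R).
Hypothesis delta_gt0 : 0 < delta.
Local Notation mu := (@lebesgue_measure R).

Let d_affine (a b x : R) : is_derive x 1 (fun t => a + b * (t - t0)) b.
Proof.
have H := is_deriveD (is_derive_cst a x 1) (is_deriveM (is_derive_cst b x 1)
  (is_deriveB (is_derive_id x 1) (is_derive_cst t0 x 1))).
apply: (@eq_ind _ _ (fun z => z) H); congr is_derive.
by rewrite /GRing.scale/=; ring.
Qed.

Let d_sin (p x : R) : is_derive x 1 (fun t => sin (p * (t - t0))) (p * cos (p * (x - t0))).
Proof.
have := @is_derive1_comp _ sin (fun t => 0 + p * (t - t0)) x _ _ (is_derive_sin _) (d_affine 0 p x).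
rewrite !add0r mulrC; congr is_derive.
by apply/funext => t /=; rewrite add0r.
Qed.

Let d_cos (p x : R) : is_derive x 1 (fun t => cos (p * (t - t0))) (- p * sin (p * (x - t0))).
Proof.
have := @is_derive1_comp _ cos (fun t => 0 + p * (t - t0)) x _ _ (is_derive_cos _) (d_affine 0 p x).
rewrite !add0r mulNr mulrC mulNr mulrC; congr is_derive.
by apply/funext => t /=; rewrite add0r.
Qed.

Lemma continuous_cos_shift p : continuous (fun t => cos (p * (t - t0))).
Proof.
move=> x; apply: differentiable_continuous; apply/derivable1_diffP.
by case: (d_cos p x).
Qed.

Lemma continuous_sin_shift p : continuous (fun t => sin (p * (t - t0))).
Proof.
move=> x; apply: differentiable_continuous; apply/derivable1_diffP.
by case: (d_sin p x).
Qed.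

Let continuous_mul (f g : R -> R) :
  continuous f -> continuous g -> continuous (fun t => f t * g t).
Proof. by move=> cf cg x; apply: (@continuousM _ _ f g); [exact: cf|exact: cg]. Qed.

Let continuous_weight (e : R) : continuous (fun t => 1 - e / delta * (t - t0)).
Proof.
have -> : (fun t => 1 - e / delta * (t - t0)) = (fun t => 1 + - (e / delta) * (t - t0)).
  by apply/funext => t; rewrite mulNr.
move=> x; apply: differentiable_continuous; apply/derivable1_diffP.
by case: (d_affine 1 (- (e / delta)) x).
Qed.

(** Each side of the tent is affine, of slope [- e / delta] with [e] equal to [1]
    on the right and [-1] on the left. *)
Lemma Rintegral_affine_cos (a b e p : R) : a < b -> p != 0 ->
  \int[mu]_(t in `[a, b]) ((1 - e / delta * (t - t0)) * cos (p * (t - t0))) =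
  ((1 - e / delta * (b - t0)) * sin (p * (b - t0)) / p
     - e / (delta * p ^+ 2) * cos (p * (b - t0))) -
  ((1 - e / delta * (a - t0)) * sin (p * (a - t0)) / p
     - e / (delta * p ^+ 2) * cos (p * (a - t0))).
Proof.
move=> ab p0.
apply: (@Rintegral_derivative _ (fun t => (1 - e / delta * (t - t0)) * sin (p * (t - t0)) / p
     - e / (delta * p ^+ 2) * cos (p * (t - t0)))) => //.
  move=> x.
  have H1 := is_deriveM (d_affine 1 (- (e / delta)) x) (d_sin p x).
  have H := is_deriveB (is_deriveM H1 (is_derive_cst p^-1 x 1))
    (is_deriveM (is_derive_cst (e / (delta * p ^+ 2)) x 1) (d_cos p x)).
  apply: (@eq_ind _ _ (fun z => z) H); congr is_derive.
    by apply/funext => t; rewrite !fctE; ring.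
  rewrite /= !fctE /GRing.scale/=; field.
  by rewrite p0 gt_eqF.
apply: continuous_mul; last exact: continuous_cos_shift.
exact: continuous_weight.
Qed.

Lemma Rintegral_affine_sin (a b e p : R) : a < b -> p != 0 ->
  \int[mu]_(t in `[a, b]) ((1 - e / delta * (t - t0)) * sin (p * (t - t0))) =
  (- (1 - e / delta * (b - t0)) * cos (p * (b - t0)) / p
     - e / (delta * p ^+ 2) * sin (p * (b - t0))) -
  (- (1 - e / delta * (a - t0)) * cos (p * (a - t0)) / p
     - e / (delta * p ^+ 2) * sin (p * (a - t0))).
Proof.
move=> ab p0.
apply: (@Rintegral_derivative _ (fun t => - (1 - e / delta * (t - t0)) * cos (p * (t - t0)) / p
     - e / (delta * p ^+ 2) * sin (p * (t - t0)))) => //.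
  move=> x.
  have H1 := is_deriveM (d_affine (-1) (e / delta) x) (d_cos p x).
  have H := is_deriveB (is_deriveM H1 (is_derive_cst p^-1 x 1))
    (is_deriveM (is_derive_cst (e / (delta * p ^+ 2)) x 1) (d_sin p x)).
  apply: (@eq_ind _ _ (fun z => z) H); congr is_derive.
    by apply/funext => t; rewrite !fctE; ring.
  rewrite /= !fctE /GRing.scale/=; field.
  by rewrite p0 gt_eqF.
apply: continuous_mul; last exact: continuous_sin_shift.
exact: continuous_weight.
Qed.

(** Integration against the tent centred at [t0], as the sum over its two sides,
    which avoids the absolute value. *)
Definition tent_integral (h : R -> R) : R :=
  \int[mu]_(t in `[t0 - delta, t0]) ((1 - (-1) / delta * (t - t0)) * h t) +
  \int[mu]_(t in `[t0, t0 + delta]) ((1 - 1 / delta * (t - t0)) * h t).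

Let ltl : t0 - delta < t0. Proof. by rewrite ltrBlDr ltrDl. Qed.
Let ltr : t0 < t0 + delta. Proof. by rewrite ltrDl. Qed.

Lemma tent_integral_cos p : tent_integral (fun t => cos (p * (t - t0))) = tent delta p.
Proof.
have d0 : delta != 0 by rewrite gt_eqF.
rewrite /tent_integral /tent; have [->|p0] := eqVneq p 0; last first.
  rewrite !Rintegral_affine_cos// [t0 - delta - t0]addrAC [t0 + delta - t0]addrAC subrr add0r.
  rewrite add0r !mulr0 !mulrN sin0 cos0 cosN sinN.
  by field; rewrite p0 d0.
have h e a b : a < b -> \int[mu]_(t in `[a, b]) ((1 - e / delta * (t - t0)) * cos (0 * (t - t0)))
    = ((b - t0) - e / delta / 2 * (b - t0) ^+ 2) - ((a - t0) - e / delta / 2 * (a - t0) ^+ 2).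
  move=> ab.
  apply: (@Rintegral_derivative _
    (fun t => (t - t0) - e / delta / 2 * (t - t0) ^+ 2)) => //.
    move=> x; have H := is_deriveM (d_affine 1 (- (e / delta / 2)) x) (d_affine 0 1 x).
    apply: (@eq_ind _ _ (fun z => z) H).
    congr is_derive; first by apply/funext => t; rewrite !fctE; ring.
    by rewrite /= /GRing.scale/= mul0r cos0; field.
  apply: continuous_mul; last exact: continuous_cos_shift.
  exact: continuous_weight.
rewrite !h// [t0 - delta - t0]addrAC [t0 + delta - t0]addrAC subrr add0r.
by rewrite add0r; field.
Qed.

Lemma tent_integral_sin p : tent_integral (fun t => sin (p * (t - t0))) = 0.
Proof.
have d0 : delta != 0 by rewrite gt_eqF.
rewrite /tent_integral; have [->|p0] := eqVneq p 0; last first.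
  rewrite !Rintegral_affine_sin// [t0 - delta - t0]addrAC [t0 + delta - t0]addrAC subrr add0r.
  rewrite add0r !mulr0 !mulrN sin0 cos0 cosN sinN.
  by field; rewrite p0 d0.
have h e a b : \int[mu]_(t in `[a, b]) ((1 - e / delta * (t - t0)) * sin (0 * (t - t0))) = 0.
  under eq_Rintegral do rewrite mul0r sin0 mulr0.
  by rewrite Rintegral_cst// mul0r.
by rewrite !h addr0.
Qed.

Let integrable_tent e a b (h : R -> R) : continuous h ->
  mu.-integrable `[a, b] (EFin \o (fun t => (1 - e / delta * (t - t0)) * h t)).
Proof.
move=> ch; apply: continuous_compact_integrable; first exact: segment_compact.
apply: continuous_subspaceT; apply: continuous_mul; last exact: ch.
exact: continuous_weight.
Qed.

Lemma tent_integralD (h1 h2 : R -> R) : continuous h1 -> continuous h2 ->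
  tent_integral (fun t => h1 t + h2 t) = tent_integral h1 + tent_integral h2.
Proof.
move=> c1 c2; rewrite /tent_integral.
have half e a b : \int[mu]_(t in `[a, b]) ((1 - e / delta * (t - t0)) * (h1 t + h2 t)) =
    \int[mu]_(t in `[a, b]) ((1 - e / delta * (t - t0)) * h1 t) +
    \int[mu]_(t in `[a, b]) ((1 - e / delta * (t - t0)) * h2 t).
  rewrite -RintegralD//; try exact: integrable_tent.
  by apply: eq_Rintegral => t _; rewrite -mulrDr.
rewrite !half.
by rewrite addrACA.
Qed.

Lemma tent_integralZ (a : R) (h : R -> R) : continuous h ->
  tent_integral (fun t => a * h t) = a * tent_integral h.
Proof.
move=> c1; rewrite /tent_integral.
have half e x y : \int[mu]_(t in `[x, y]) ((1 - e / delta * (t - t0)) * (a * h t)) =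
    a * \int[mu]_(t in `[x, y]) ((1 - e / delta * (t - t0)) * h t).
  rewrite -RintegralZl//; last exact: integrable_tent.
  by apply: eq_Rintegral => t _; rewrite mulrCA.
by rewrite !half -mulrDr.
Qed.

Lemma tent_integral_le (h : R -> R) (I : set R) : continuous h ->
  measurable I -> `[t0 - delta, t0 + delta]%classic `<=` I ->
  (`|tent_integral h|%:E <=
   2%:E * \int[mu]_(t in I) `|h t|%:E)%E.
Proof.
move=> ch mI subI.
have half e a b : (forall t, t \in `[a, b] -> `|1 - e / delta * (t - t0)| <= 1) ->
   [set` `[a, b]] `<=` I ->
   (`|\int[mu]_(t in `[a, b]) ((1 - e / delta * (t - t0)) * h t)|%:E <=
    \int[mu]_(t in I) `|h t|%:E)%E.
  move=> e1 sub.
  have mh D : measurable D -> measurable_fun D (fun t => (`|h t| : R)%:E).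
    move=> mD; apply: measurableT_comp => //; apply: measurableT_comp => //.
    apply: measurable_funTS; exact: continuous_measurable_fun.
  apply: (@le_trans _ _ (\int[mu]_(t in `[a, b]) `|h t|%:E)%E); last first.
    by apply: ge0_subset_integral => //; exact: mh.
  rewrite EFin_normr_Rintegral//; last exact: integrable_tent.
  apply: le_trans (le_abse_integral _ _ _) _ => //.
    by case/integrableP: (@integrable_tent e a b h ch).
  apply: ge0_le_integral.
  - by [].
  - by [].
  - apply: measurableT_comp => //.
    by case/integrableP: (@integrable_tent e a b h ch).
  - exact: mh.
  - by move=> t tab; rewrite /= lee_fin normrM ler_piMl// e1.
rewrite -[2]/(1 + 1) EFinD ge0_muleDl// mul1e.
apply: le_trans (leeD (half (-1) (t0 - delta) t0 _ _) (half 1 t0 (t0 + delta) _ _)).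
- by rewrite -EFinD lee_fin ler_normD.
- move=> t; rewrite in_itv/= => /andP[ta tb].
  have : -1 <= (t - t0) / delta <= 0.
    by rewrite ler_pdivlMr// ler_pdivrMr//; apply/andP; split; lra.
  rewrite -mulrA mulN1r [delta^-1 * _]mulrC ler_norml; lra.
- move=> t /=; rewrite in_itv/= => /andP[ta tb]; apply: subI.
  by rewrite /= in_itv/=; apply/andP; split; lra.
- move=> t; rewrite in_itv/= => /andP[ta tb].
  have : 0 <= (t - t0) / delta <= 1.
    by rewrite ler_pdivlMr// ler_pdivrMr//; apply/andP; split; lra.
  rewrite -mulrA mul1r [delta^-1 * _]mulrC ler_norml; lra.
- move=> t /=; rewrite in_itv/= => /andP[ta tb]; apply: subI.
  by rewrite /= in_itv/=; apply/andP; split; lra.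
Qed.

End tent_integral.

(** * Measurability of complex functions *)

Definition cmeasurable (R : realType) (D : set R) (f : R -> R[i]) : Prop :=
  measurable_fun D (fun t => complex.Re (f t)) /\
  measurable_fun D (fun t => complex.Im (f t)).

Lemma cmeasurableD (R : realType) (D : set R) (f g : R -> R[i]) :
  cmeasurable D f -> cmeasurable D g -> cmeasurable D (fun t => f t + g t).
Proof.
move=> [fr fi] [gr gi]; split.
  apply: (eq_measurable_fun _ _ (measurable_funD fr gr)) => t _ /=.
  by case: (f t) => a b; case: (g t).
apply: (eq_measurable_fun _ _ (measurable_funD fi gi)) => t _ /=.
by case: (f t) => a b; case: (g t).
Qed.

Lemma cmeasurableM (R : realType) (D : set R) (f g : R -> R[i]) :
  cmeasurable D f -> cmeasurable D g -> cmeasurable D (fun t => f t * g t).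
Proof.
move=> [fr fi] [gr gi]; split.
  apply: (eq_measurable_fun _ _
    (measurable_funB (measurable_funM fr gr) (measurable_funM fi gi))) => t _ /=.
  by rewrite ReM_complex.
apply: (eq_measurable_fun _ _
  (measurable_funD (measurable_funM fr gi) (measurable_funM fi gr))) => t _ /=.
by rewrite ImM_complex.
Qed.

Lemma cmeasurable_cst (R : realType) (D : set R) (z : R[i]) :
  cmeasurable D (fun=> z).
Proof. by split; exact: measurable_cst. Qed.

Lemma cmeasurableB (R : realType) (D : set R) (f g : R -> R[i]) :
  cmeasurable D f -> cmeasurable D g -> cmeasurable D (fun t => f t - g t).
Proof.
move=> mf mg; have := cmeasurableD mf (cmeasurableM (cmeasurable_cst D (-1)) mg).
by under eq_fun do rewrite mulN1r.
Qed.

Lemma cmeasurable_expi (R : realType) (D : set R) : cmeasurable D (@expi R).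
Proof.
split; apply: measurable_funTS; apply: continuous_measurable_fun.
  exact: continuous_cos.
exact: continuous_sin.
Qed.

Lemma cmeasurable_trig_poly (R : realType) (D : set R) (d : nat -> R[i]) J :
  cmeasurable D (fun t => \sum_(0 <= j < J) d j * expi t ^+ j).
Proof.
elim: J => [|J IH].
  by under eq_fun do rewrite big_geq//; exact: cmeasurable_cst.
under eq_fun do rewrite big_nat_recr//=.
apply: cmeasurableD => //; apply: cmeasurableM; first exact: cmeasurable_cst.
elim: J {IH} => [|J IH]; first exact: cmeasurable_cst.
under eq_fun do rewrite exprS.
by apply: cmeasurableM => //; exact: cmeasurable_expi.
Qed.

Lemma measurable_normc (R : realType) (D : set R) (f : R -> R[i]) :
  cmeasurable D f -> measurable_fun D (fun t => (normc (f t))%:E).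
Proof.
move=> [fr fi]; apply/measurable_EFinP.
have m2 := measurable_funD (measurable_funX 2 fr) (measurable_funX 2 fi).
have ms : measurable_fun setT (@Num.sqrt R).
  by apply: continuous_measurable_fun; exact: sqrt_continuous.
apply: (eq_measurable_fun _ _ (measurableT_comp ms m2)) => t _ /=.
by case: (f t).
Qed.

(** * The local smoothing estimate *)

Section local_smoothing.
Context (R : realType) (t0 delta : R) (I : set R).
Hypotheses (cos_t0 : cos t0 = 1) (sin_t0 : sin t0 = 0) (delta_gt0 : 0 < delta).
Hypotheses (mI : measurable I)
  (subI : `[t0 - delta, t0 + delta]%classic `<=` I).
Local Notation mu := (@lebesgue_measure R).

(* e^(i t0) = 1, so the frequencies may be centred at t0. *)
Let expi_shift t : expi t = expi (t - t0).
Proof.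
rewrite -{1}(subrK t0 t) (expiD (t - t0)).
rewrite [X in _ * X](_ : _ = 1) ?mulr1//.
by rewrite /expi cos_t0 sin_t0.
Qed.

Let Re_trig_poly (d : nat -> R[i]) (n J : nat) t :
  complex.Re (expi (- n%:R * (t - t0)) * \sum_(0 <= j < J) d j * expi t ^+ j) =
  \sum_(0 <= j < J) (complex.Re (d j) * cos ((j%:R - n%:R) * (t - t0)) +
                    - complex.Im (d j) * sin ((j%:R - n%:R) * (t - t0))).
Proof.
rewrite mulr_sumr raddf_sum; apply: eq_bigr => j _ /=.
rewrite mulrCA (expi_shift t) expiX -expiD -mulrDl addrC.
by rewrite ReM_complex /expi/= mulNr.
Qed.

Let tent_integral_Re (d : nat -> R[i]) (n J : nat) :
  let h := fun t => \sum_(0 <= j < J)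
    (complex.Re (d j) * cos ((j%:R - n%:R) * (t - t0)) +
     - complex.Im (d j) * sin ((j%:R - n%:R) * (t - t0))) in
  continuous h /\ tent_integral t0 delta h =
    \sum_(0 <= j < J) complex.Re (d j) * tent delta (j%:R - n%:R).
Proof.
elim: J => [|J [IHc IHi]] /=.
  rewrite big_geq//; under eq_fun do rewrite big_geq//.
  split; first exact: cst_continuous.
  have c0 : continuous (fun _ : R => 0 : R) by exact: cst_continuous.
  have := tent_integralZ t0 delta 0 c0; rewrite [RHS]mul0r => h0.
  rewrite -[RHS]h0; apply: f_equal; by apply/funext => t; rewrite mul0r.
rewrite big_nat_recr//=; under eq_fun do rewrite big_nat_recr//=.
set p := J%:R - n%:R.
have cc a : continuous (fun t => a * cos (p * (t - t0))).
  move=> x; apply: (@continuousM _ _ (fun=> a) (fun t => cos (p * (t - t0)))).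
    exact: cst_continuous.
  exact: continuous_cos_shift.
have cs a : continuous (fun t => a * sin (p * (t - t0))).
  move=> x; apply: (@continuousM _ _ (fun=> a) (fun t => sin (p * (t - t0)))).
    exact: cst_continuous.
  exact: continuous_sin_shift.
have cD (f g : R -> R) : continuous f -> continuous g -> continuous (fun t => f t + g t).
  by move=> cf cg x; apply: (@continuousD _ _ _ f g); [exact: cf|exact: cg].
split; first exact: (cD _ _ IHc (cD _ _ (cc _) (cs _))).
rewrite (tent_integralD _ _ IHc (cD _ _ (cc _) (cs _))).
rewrite IHi tent_integralD// !tent_integralZ.
- by rewrite tent_integral_cos// tent_integral_sin// mulr0 addr0.
- exact: continuous_sin_shift.
- exact: continuous_cos_shift.
Qed.

(** The left-hand side is the integral, against the tent, of the real part of
    [e^(- i n (t - t0))] times the trigonometric polynomial, whose modulus does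
    not depend on [n]. *)
Lemma Re_local_smoothing_le (d : nat -> R[i]) (n J : nat) :
  (`|\sum_(0 <= j < J) complex.Re (d j) * tent delta (j%:R - n%:R)|%:E <=
   2%:E * \int[mu]_(t in I)
     (normc (\sum_(0 <= j < J) d j * expi t ^+ j))%:E)%E.
Proof.
have [ch <-] := tent_integral_Re d n J.
apply: le_trans (tent_integral_le delta_gt0 ch mI subI) _.
apply: lee_pmul => //; first by apply: integral_ge0.
apply: ge0_le_integral => //.
- apply/measurable_EFinP; apply: measurableT_comp => //.
  by apply: measurable_funTS; exact: continuous_measurable_fun.
- by apply: measurable_normc; exact: cmeasurable_trig_poly.
- move=> t _; rewrite lee_fin -Re_trig_poly (le_trans (ler_normc_Re _))//.
  by rewrite normcM normc_expi mul1r.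
Qed.

(** The imaginary part is the real part for the coefficients [- i d_j], which
    doubles the constant. *)
Lemma local_smoothing_le (d : nat -> R[i]) (n J : nat) :
  ((normc (\sum_(0 <= j < J) (tent delta (j%:R - n%:R))%:C%C * d j))%:E <=
   4%:E * \int[mu]_(t in I)
     (normc (\sum_(0 <= j < J) d j * expi t ^+ j))%:E)%E.
Proof.
set X := (\int[mu]_(t in I) _)%E.
have reE : complex.Re (\sum_(0 <= j < J) (tent delta (j%:R - n%:R))%:C%C * d j)
    = \sum_(0 <= j < J) complex.Re (d j) * tent delta (j%:R - n%:R).
  rewrite raddf_sum; apply: eq_bigr => j _ /=.
  by rewrite ReM_complex/= mul0r subr0 mulrC.
have imE : complex.Im (\sum_(0 <= j < J) (tent delta (j%:R - n%:R))%:C%C * d j)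
    = \sum_(0 <= j < J) complex.Re (- 'i%C * d j) * tent delta (j%:R - n%:R).
  rewrite raddf_sum; apply: eq_bigr => j _ /=.
  by rewrite ImM_complex/= ReM_complex/= oppr0 !mul0r addr0 mulN1r sub0r opprK mulrC.
apply: (@le_trans _ _ (2%:E * X + 2%:E * X)%E); last first.
  by rewrite -ge0_muleDl// -EFinD -natrD.
have h1 := Re_local_smoothing_le d n J.
have h2 := Re_local_smoothing_le (fun j => - 'i%C * d j) n J.
apply: le_trans (leeD h1 _); last first.
  apply: le_trans h2 _; rewrite /X le_eqVlt; apply/orP; left; apply/eqP.
  congr (_ * _)%E; apply: eq_integral => t _; congr EFin.
  under eq_bigr do rewrite -mulrA.
  rewrite -mulr_sumr normcM (normcN ('i%C : Rcomplex R)).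
  by rewrite {1}/normc/= expr0n/= add0r expr1n sqrtr1 mul1r.
by rewrite -EFinD lee_fin -reE -imE normc_le_ReIm.
Qed.

End local_smoothing.

(** * Power series with bounded coefficients *)

Lemma cvg_complex (R : realType) (u : nat -> R[i]) :
  cvgn (fun n => complex.Re (u n)) -> cvgn (fun n => complex.Im (u n)) ->
  cvgn (u : (R[i]^o)^nat).
Proof.
move=> cr ci; apply/cvg_ex.
exists ((limn (fun n => complex.Re (u n)) +i* limn (fun n => complex.Im (u n)))%C : R[i]^o).
apply/cvgrPdist_lt => e e0.
have eE : e = (complex.Re e)%:C%C by rewrite RRe_real// gtr0_real.
have e0' : 0 < complex.Re e by rewrite eE ltcR in e0.
have /cvgrPdist_lt/(_ (complex.Re e / 2)) := cr.
have /cvgrPdist_lt/(_ (complex.Re e / 2)) := ci.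
rewrite divr_gt0// => /(_ isT) Hi /(_ isT) Hr.
near=> n.
have hr : `|limn (fun n => complex.Re (u n)) - complex.Re (u n)| < complex.Re e / 2.
  by near: n.
have hi : `|limn (fun n => complex.Im (u n)) - complex.Im (u n)| < complex.Re e / 2.
  by near: n.
rewrite normC_normc eE ltcR (le_lt_trans (normc_le_ReIm _))//.
case: (u n) hr hi => a b /= hr hi; rewrite [ltRHS]splitr; exact: ltrD.
Unshelve. all: by end_near. Qed.

Lemma geometric_tail_le (R : realType) (s : R) J N : 0 <= s -> s < 1 ->
  \sum_(J <= j < N) s ^+ j <= s ^+ J / (1 - s).
Proof.
move=> s0 s1; have [JN|NJ] := leqP J N; last first.
  by rewrite big_geq 1?ltnW// divr_ge0 ?exprn_ge0// subr_ge0 ltW.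
have s1' : 0 < 1 - s by rewrite subr_gt0.
rewrite ler_pdivlMr// mulr_suml.
have -> : \sum_(J <= j < N) s ^+ j * (1 - s) = s ^+ J - s ^+ N.
  rewrite -[RHS]opprB -(@telescope_sumr _ _ _ (fun j => s ^+ j))// -sumrN.
  apply: eq_bigr => j _.
  by rewrite exprS; ring.
by rewrite gerBl exprn_ge0.
Qed.

Section bounded_coefficients.
Context (R : realType) (a : nat -> R[i]) (M : R).
Hypothesis aM : forall n, normc (a n) <= M.

Lemma power_series_cvg (z : R[i]) : normc z < 1 ->
  cvgn (series (fun n : nat => a n * z ^+ n) : (R[i]^o)^nat).
Proof.
move=> z1; apply: cvg_complex.
- have -> : (fun n => complex.Re (series (fun n : nat => a n * z ^+ n) n)) =
     series (fun n => complex.Re (a n * z ^+ n)).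
    by apply/funext => n; rewrite /series/= raddf_sum.
  apply: normed_cvg; apply: (@series_le_cvg _ _ (geometric M (normc z))).
  + by move=> n; exact: normr_ge0.
  + move=> n /=; rewrite mulr_ge0 ?exprn_ge0 ?normc_ge0//.
    by apply: le_trans (aM 0%N); exact: normc_ge0.
  + move=> n /=; rewrite (le_trans (ler_normc_Re _))// normcM normcX.
    by rewrite ler_wpM2r// exprn_ge0// normc_ge0.
  + by apply: is_cvg_geometric_series; rewrite ger0_norm ?normc_ge0.
- have -> : (fun n => complex.Im (series (fun n : nat => a n * z ^+ n) n)) =
     series (fun n => complex.Im (a n * z ^+ n)).
    by apply/funext => n; rewrite /series/= raddf_sum.
  apply: normed_cvg; apply: (@series_le_cvg _ _ (geometric M (normc z))).
  + by move=> n; exact: normr_ge0.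
  + move=> n /=; rewrite mulr_ge0 ?exprn_ge0 ?normc_ge0//.
    by apply: le_trans (aM 0%N); exact: normc_ge0.
  + move=> n /=.
    have -> : `|complex.Im (a n * z ^+ n)| = `|complex.Re ('i%C * (a n * z ^+ n))|.
      by rewrite ReM_complex/= mul0r mul1r sub0r normrN.
    rewrite (le_trans (ler_normc_Re _))// normcM.
    rewrite {1}/normc/= expr0n/= add0r expr1n sqrtr1 mul1r normcM normcX.
    by rewrite ler_wpM2r// exprn_ge0// normc_ge0.
  + by apply: is_cvg_geometric_series; rewrite ger0_norm ?normc_ge0.
Qed.

Lemma power_series_tail_le (z : R[i]) J : normc z < 1 ->
  normc (limn (series (fun n : nat => a n * z ^+ n) : (R[i]^o)^nat)
         - \sum_(0 <= j < J) a j * z ^+ j)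
  <= M * (normc z ^+ J / (1 - normc z)).
Proof.
move=> z1; apply/ler_addgt0Pr => e e0.
have M0 : 0 <= M by apply: le_trans (aM 0%N); exact: normc_ge0.
have e0' : (0 : R[i]) < e%:C%C by rewrite ltcR.
have /cvgrPdist_lt/(_ _ e0') [N _ HN] := power_series_cvg z1.
have := HN (maxn J N) (leq_maxr _ _).
rewrite /= normC_normc ltcR => h.
set L := limn _; rewrite -/L in h.
set SN := series _ _ in h.
have -> : L - \sum_(0 <= j < J) a j * z ^+ j =
   (SN - \sum_(0 <= j < J) a j * z ^+ j) + (L - SN).
  by rewrite [RHS]addrC addrA subrK.
apply: (le_trans (ler_normcD _ _)); apply: lerD; last exact: ltW.
rewrite /SN /series/= (@big_cat_nat _ _ _ J 0 (maxn J N))/= ?leq_maxl//.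
rewrite addrAC subrr add0r (le_trans (ler_normc_sum _ _ _))//.
apply: (@le_trans _ _ (M * \sum_(J <= j < maxn J N) normc z ^+ j)).
  rewrite mulr_sumr; apply: ler_sum => j _; rewrite normcM normcX.
  by rewrite ler_wpM2r// exprn_ge0// normc_ge0.
by rewrite ler_wpM2l// geometric_tail_le// normc_ge0.
Qed.

End bounded_coefficients.

(** The same estimate for the constant coefficients [alpha], from the closed form
    of the geometric sum. *)
Lemma cauchy_kernel_tail_le (R : realType) (alpha z : R[i]) J : normc z < 1 ->
  normc (alpha / (1 - z) - \sum_(0 <= j < J) alpha * z ^+ j)
  <= normc alpha * (normc z ^+ J / (1 - normc z)).
Proof.
move=> z1.
have z1' : 1 - normc z <= normc (1 - z).
  have := ler_normcD (1 - z) z; rewrite subrK normc1; lra.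
have z10 : 0 < normc (1 - z) by rewrite (lt_le_trans _ z1')// subr_gt0.
have nz : 1 - z != 0 by apply: contraTneq z10 => ->; rewrite normc0 ltxx.
have -> : alpha / (1 - z) - \sum_(0 <= j < J) alpha * z ^+ j = alpha * (z ^+ J / (1 - z)).
  rewrite -mulr_sumr -mulrBr; congr (_ * _).
  apply: (mulIf nz); rewrite mulrBl !mulfVK// ?mul1r.
  rewrite mulVf//.
  have := subrX1 z J; rewrite big_mkord => h.
  by rewrite -[1 - z]opprB mulrN opprK mulrC -h; ring.
rewrite normcM ler_wpM2l ?normc_ge0// normcM normcX normcV.
rewrite ler_wpM2l ?exprn_ge0 ?normc_ge0// lef_pV2 ?posrE//.
by rewrite subr_gt0.
Qed.

(** * The mass of the tent kernel *)

Lemma tent_dist (R : realType) (delta : R) (j m : nat) :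
  tent delta (j%:R - m%:R) = tent delta (`|Posz j - Posz m|%N)%:R.
Proof.
have [jm|mj] := leqP j m.
  rewrite -tentN opprB -natrB//; congr (tent _ _%:R); lia.
rewrite -natrB; last exact: ltnW.
congr (tent _ _%:R); lia.
Qed.

Lemma tent_series_le (R : realType) (delta : R) N : 0 < delta ->
  series (fun m => tent delta m%:R) N <= delta + 8 / delta.
Proof.
move=> d0; case: N => [|N].
  by rewrite /series/= big_geq// addr_ge0 ?divr_ge0// ltW.
(* 1 / m^2 <= 2 / m - 2 / (m + 1) makes the bound telescope *)
suff : series (fun m => tent delta m%:R) N.+1 <=
    delta + 4 / delta * (2 - 2 / N.+1%:R).
  move=> /le_trans; apply; rewrite lerD2l.
  have -> : 8 / delta = 4 / delta * 2 by field; rewrite gt_eqF.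
  by rewrite ler_wpM2l ?divr_ge0 ?(ltW d0)// gerBl divr_ge0.
elim: N => [|N IH].
  rewrite /series/= big_nat1 /tent eqxx divr1 subrr mulr0 addr0 lexx//.
rewrite /series/= in IH *; rewrite big_nat_recr//=.
have hN : (0 : R) < N.+1%:R by rewrite ltr0n.
set x := N.+1%:R : R in IH hN *.
have -> : N.+2%:R = x + 1 :> R by rewrite natr1.
apply: (le_trans (lerD IH (_ : _ <= 4 / delta * (2 / x - 2 / (x + 1))))); last first.
  by rewrite le_eqVlt; apply/orP; left; apply/eqP; ring.
rewrite /tent gt_eqF//.
apply: (@le_trans _ _ (4 / (delta * x ^+ 2))).
  rewrite ler_pM2r ?invr_gt0 ?mulr_gt0 ?exprn_gt0//.
  by have := cos_geN1 (x * delta); lra.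
have -> : 4 / (delta * x ^+ 2) = 4 / delta * x ^- 2.
  by field; rewrite !gt_eqF.
rewrite ler_wpM2l ?divr_ge0 ?(ltW d0)//.
have -> : 2 / x - 2 / (x + 1) = 2 / (x * (x + 1)).
  by field; rewrite !gt_eqF// addr_gt0.
have x1 : 1 <= x by rewrite ler1n.
rewrite ler_pdivlMr ?mulr_gt0 ?addr_gt0// mulrC ler_pdivrMr ?exprn_gt0//.
rewrite expr2; nra.
Qed.

(** * Window sums under H^1 boundary behavior *)

Lemma bernoulli_le (R : realType) (s : R) j : 0 <= s -> s <= 1 ->
  1 - s ^+ j <= j%:R * (1 - s).
Proof.
move=> s0 s1; elim: j => [|j IH]; first by rewrite expr0 subrr mul0r.
rewrite exprS -natr1.
have h : s ^+ j <= 1 by rewrite exprn_ile1.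
have : 0 <= (1 - s ^+ j) * (1 - s) by rewrite mulr_ge0 ?subr_ge0.
nra.
Qed.

(** [Z], [X] and [Y] will be a window sum, its smoothing, and the smoothing of
    the window sum at another radius. *)
Lemma normc_chain (R : realType) (S p q r : R) (X Y Z : R[i]) : 0 <= S ->
  normc (S%:C%C * Z - X) <= p -> normc (X - Y) <= q -> normc Y <= r ->
  S * normc Z <= p + r + q.
Proof.
move=> S0 hp hq hr.
have -> : S * normc Z = normc (S%:C%C * Z) by rewrite normcM normc_real ger0_norm.
rewrite -(subrK X (S%:C%C * Z)) -{2}(subrK Y X).
apply: (le_trans (ler_normcD _ _)); rewrite -[leRHS]addrA (addrC r q); apply: lerD => //.
by apply: (le_trans (ler_normcD _ _)); apply: lerD.
Qed.

Section window_average.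
Context (R : realType) (b : nat -> R[i]) (K : R) (g : R[i] -> R[i]).
Hypothesis bK : forall j, normc (b j) <= K.
Hypothesis g_tail : forall z J, normc z < 1 ->
  normc (g z - \sum_(0 <= j < J) b j * z ^+ j)
    <= K * (normc z ^+ J / (1 - normc z)).
Local Notation mu := (@lebesgue_measure R).

Let K_ge0 : 0 <= K. Proof. by apply: le_trans (bK 0%N); exact: normc_ge0. Qed.

(** Partial sums of the series replace [g] on the circles of radius [r] and [s],
    up to the uniform error of the tails; [F] serves as the middle term. *)
Lemma L1_dist_partial_sums (I : set R) (F : R -> R[i]) (r s : R) J :
  measurable I -> 0 <= r -> r < 1 -> 0 <= s -> s < 1 ->
  cmeasurable I F ->
  cmeasurable I (fun t => g (r%:C%C * expi t)) ->
  cmeasurable I (fun t => g (s%:C%C * expi t)) ->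
  (\int[mu]_(t in I) (normc (\sum_(0 <= j < J)
      (b j * s%:C%C ^+ j - b j * r%:C%C ^+ j) * expi t ^+ j))%:E <=
   \int[mu]_(t in I) (normc (g (s%:C%C * expi t) - F t))%:E +
   \int[mu]_(t in I) (normc (g (r%:C%C * expi t) - F t))%:E +
   (K * (s ^+ J / (1 - s)) + K * (r ^+ J / (1 - r)))%:E * mu I)%E.
Proof.
move=> mI r0 r1 s0 s1 mF mr ms.
pose C : R := K * (s ^+ J / (1 - s)) + K * (r ^+ J / (1 - r)).
have C0 : 0 <= C.
  by apply: addr_ge0; apply: mulr_ge0 => //; apply: divr_ge0;
    rewrite ?exprn_ge0// subr_ge0 ltW.
have ncirc x t : 0 <= x -> normc (x%:C%C * expi t) = x.
  by move=> x0; rewrite normcM normc_real normc_expi mulr1 ger0_norm.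
rewrite -(integral_cst mu mI C%:E).
have n0 (f : R -> R[i]) t : I t -> (0 <= (normc (f t))%:E)%E.
  by move=> _; rewrite lee_fin normc_ge0.
have m1 := measurable_normc (cmeasurableB ms mF).
have m2 := measurable_normc (cmeasurableB mr mF).
rewrite -ge0_integralD//; try by move=> *; rewrite lee_fin normc_ge0.
rewrite -ge0_integralD//.
- apply: ge0_le_integral => //.
  + by move=> *; rewrite lee_fin normc_ge0.
  + by apply: measurable_normc; exact: cmeasurable_trig_poly.
  + by apply: emeasurable_funD => //; apply: emeasurable_funD.
  move=> t It; rewrite -!EFinD lee_fin.
  have tl x : 0 <= x -> x < 1 -> normc (g (x%:C%C * expi t) -
      \sum_(0 <= j < J) b j * x%:C%C ^+ j * expi t ^+ j) <= K * (x ^+ J / (1 - x)).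
    move=> x0 x1; have := @g_tail (x%:C%C * expi t) J.
    rewrite ncirc// => /(_ x1).
    by under eq_bigr do rewrite exprMn mulrA.
  have -> : \sum_(0 <= j < J) (b j * s%:C%C ^+ j - b j * r%:C%C ^+ j) * expi t ^+ j =
     ((g (s%:C%C * expi t) - F t) - (g (r%:C%C * expi t) - F t)) -
     ((g (s%:C%C * expi t) - \sum_(0 <= j < J) b j * s%:C%C ^+ j * expi t ^+ j)
     - (g (r%:C%C * expi t) - \sum_(0 <= j < J) b j * r%:C%C ^+ j * expi t ^+ j)).
    under eq_bigr do rewrite mulrBl.
    have id (x y z p q : R[i]) : p - q = ((x - z) - (y - z)) - ((x - p) - (y - q)).
      by ring.
    by rewrite sumrB; exact: id.
  apply: (le_trans (normcB _ _)); apply: lerD; first exact: normcB.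
  by apply: (le_trans (normcB _ _)); apply: lerD; apply: tl.
- by move=> *; rewrite -EFinD lee_fin addr_ge0 ?normc_ge0.
- exact: emeasurable_funD.
Qed.

(** The core of the argument. The radius [r] is fixed first, close enough to 1
    for the L^1 distance to nearby radii; then the window length [k] makes the
    kernel tails and the bounded sums at radius [r] negligible against [k]. *)
Lemma window_average_small (e : R) : 0 < e -> H1_boundary g 1 ->
  exists k0, forall k n, (k0 <= k)%N ->
    normc (\sum_(n <= j < n + k) b j) <= e * k%:R.
Proof.
move=> e0 [t0 [dl [F]]] /=; set I := `]_, _[%classic.
move=> [et0 dl0 iF ig gF].
have mI : measurable I by exact: measurable_itv.
have cos_t0 : cos t0 = 1 by case: et0.
have sin_t0 : sin t0 = 0 by case: et0.
pose delta := dl / 2.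
have d0 : 0 < delta by rewrite divr_gt0.
have subI : `[t0 - delta, t0 + delta]%classic `<=` I.
  move=> t; rewrite /I /= !in_itv/= => /andP[h1 h2].
  by rewrite /delta in h1 h2; apply/andP; split; lra.
pose c m := tent delta m%:R.
have c0 m : 0 <= c m by exact: tent_ge0.
have ndc : {homo series c : n m / (n <= m)%N >-> n <= m}.
  by apply/nondecreasing_seqP => n; rewrite /series/= big_nat_recr//= lerDl.
have cvc : cvgn (series c).
  apply: nondecreasing_is_cvgn => //; exists (delta + 8 / delta) => _ [n _ <-].
  exact: tent_series_le.
pose A := limn (series c).
have cA N : series c N <= A by exact: nondecreasing_cvgn_le.
pose S := 2 * A - c 0%N.
have S0 : 0 < S.
  have := cA 1%N; rewrite /series/= big_nat1 /S.
  have : 0 < c 0%N by rewrite /c /tent eqxx.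
  lra.
pose T k := \sum_(0 <= i < k) (A - series c i.+1).
have T0 : (fun k => k.+1%:R^-1 * T k.+1) @ \oo --> (0 : R).
  have : (fun i => A - series c i.+1) @ \oo --> (0 : R).
    rewrite -(subrr A); apply: cvgB; first exact: cvg_cst.
    by rewrite (cvg_shiftS (series c)).
  by move=> /cesaro.
(* three error terms: twice e S / 4 for k large, and 8 eta = e S / 2 *)
pose eta := e * S / 16.
have eta0 : 0 < eta by rewrite divr_gt0 ?mulr_gt0.
have near1 : \forall r \near 1^'-, [/\ 0 < r, r < 1,
    cmeasurable I (fun t => g (r%:C%C * expi t)) &
    (\int[mu]_(t in I) (normc (g (r%:C%C * expi t) - F (expi t)))%:E <= (eta / 4)%:E)%E].
  move/fine_cvgP : gF => [ffin fcvg].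
  have fsmall : \forall r \near 1^'-,
      fine (\int[mu]_(t in I) (normc (g (r%:C%C * expi t) - F (expi t)))%:E)%E < eta / 4.
    by apply: (cvgr_lt 0 fcvg); rewrite divr_gt0.
  near=> r; split.
  - by near: r; exact: nbhs_left_gt.
  - by near: r; exact: nbhs_left_lt.
  - have [/integrableP[/measurable_EFinP m1 _] /integrableP[/measurable_EFinP m2 _]] :
      cintegrable I (fun t => g (r%:C%C * expi t)) by near: r.
    by split.
  - rewrite -[X in (X <= _)%E]fineK; last by near: r.
    by rewrite lee_fin ltW//; near: r.
have mF : cmeasurable I (fun t => F (expi t)).
  by case: iF => /integrableP[/measurable_EFinP m1 _] /integrableP[/measurable_EFinP m2 _].
have [r [r0 r1 mr intr]] := filter_ex near1.
have muI : mu I = (2 * dl)%:E.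
  rewrite lebesgue_measure_itv/= lte_fin -EFinB ifT; last by lra.
  by congr EFin; lra.
have geo_cvg x : 0 < x -> x < 1 ->
    (fun J => K * (x ^+ J / (1 - x)) * (2 * dl)) @ \oo --> (0 : R).
  move=> x0 x1; rewrite [X in _ --> X](_ : 0 = K * (0 / (1 - x)) * (2 * dl)); last first.
    by rewrite mul0r mulr0 mul0r.
  apply: cvgMr_tmp; apply: cvgMl_tmp; apply: cvgMr_tmp.
  by apply: cvg_expr; rewrite gtr0_norm.
have V_small s n k : 0 < s -> s < 1 -> cmeasurable I (fun t => g (s%:C%C * expi t)) ->
    (\int[mu]_(t in I) (normc (g (s%:C%C * expi t) - F (expi t)))%:E <= (eta / 4)%:E)%E ->
    S * normc (\sum_(n <= j < n + k) b j * s%:C%C ^+ j) <=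
      4 * K * T k + S * (K / (1 - r)) + 4 * eta * k%:R.
  move=> s0 s1 ms ints.
  (* a truncation beyond the window whose two tails are negligible on I *)
  have [J [Jnk tails]] : exists J, (n + k <= J)%N /\
     K * (s ^+ J / (1 - s)) * (2 * dl) + K * (r ^+ J / (1 - r)) * (2 * dl) < eta / 2.
    have : \forall J \near \oo,
      K * (s ^+ J / (1 - s)) * (2 * dl) + K * (r ^+ J / (1 - r)) * (2 * dl) < eta / 2.
      have h : (fun J => K * (s ^+ J / (1 - s)) * (2 * dl) +
          K * (r ^+ J / (1 - r)) * (2 * dl)) @ \oo --> (0 : R).
        rewrite -[X in _ --> X](addr0 (0 : R)).
        exact: (cvgD (geo_cvg s s0 s1) (geo_cvg r r0 r1)).
      by apply: (cvgr_lt 0 h); rewrite divr_gt0.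
    move=> [N _ HN]; exists (maxn N (n + k)); split; first exact: leq_maxr.
    by apply: HN; exact: leq_maxl.
  have bsK x : 0 <= x -> x < 1 -> forall j, normc (b j * x%:C%C ^+ j) <= K * x ^+ j.
    move=> x0 x1 j; rewrite normcM normcX normc_real ger0_norm//.
    by rewrite ler_wpM2r ?exprn_ge0.
  have dist m : normc (\sum_(0 <= j < J) (c `|Posz j - Posz m|%N)%:C%C *
       (b j * s%:C%C ^+ j - b j * r%:C%C ^+ j)) <= 4 * eta.
    rewrite -lee_fin.
    have := local_smoothing_le cos_t0 sin_t0 d0 mI subI
      (fun j => b j * s%:C%C ^+ j - b j * r%:C%C ^+ j) m J.
    under eq_bigr do rewrite tent_dist.
    move=> /le_trans; apply; rewrite EFinM lee_wpmul2l//.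
    apply: (le_trans (L1_dist_partial_sums J mI (ltW r0) r1 (ltW s0) s1 mF mr ms)).
    apply: (@le_trans _ _ ((eta / 4)%:E + (eta / 4)%:E + (eta / 2)%:E)%E).
      apply: leeD; first exact: leeD.
      by rewrite muI -EFinM lee_fin mulrDl ltW.
    by rewrite -!EFinD lee_fin; lra.
  have D := smoothing_defect c0 cA (M := K) (d := fun j => b j * s%:C%C ^+ j) _ Jnk.
  have {}D := D (fun j => le_trans (bsK s (ltW s0) s1 j) _).
  have {}D := D (fun j => ler_piMr K_ge0 (exprn_ile1 j (ltW s0) (ltW s1))).
  have B := smoothing_sum_le c0 cA (fun j => b j * r%:C%C ^+ j) n k J.
  have {}B := le_trans B (ler_wpM2l (ltW S0) (_ : _ <= K / (1 - r))).
  have {}B : normc (\sum_(n <= m < n + k) \sum_(0 <= j < J)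
      (c `|Posz j - Posz m|%N)%:C%C * (b j * r%:C%C ^+ j)) <= S * (K / (1 - r)).
    apply: B; apply: (@le_trans _ _ (K * \sum_(0 <= j < J) r ^+ j)).
      by rewrite mulr_sumr; apply: ler_sum => j _; exact: bsK (ltW r0) r1 j.
    rewrite ler_wpM2l// (le_trans (geometric_tail_le _ _ (ltW r0) r1))//.
    by rewrite expr0 mul1r.
  have E : normc (\sum_(n <= m < n + k) \sum_(0 <= j < J)
      (c `|Posz j - Posz m|%N)%:C%C * (b j * s%:C%C ^+ j) -
      \sum_(n <= m < n + k) \sum_(0 <= j < J)
      (c `|Posz j - Posz m|%N)%:C%C * (b j * r%:C%C ^+ j)) <= 4 * eta * k%:R.
    rewrite -sumrB (le_trans (ler_normc_sum _ _ _))//.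
    apply: (@le_trans _ _ (\sum_(n <= m < n + k) 4 * eta)).
      apply: ler_sum => m _; rewrite -sumrB.
      by under eq_bigr do rewrite -mulrBr; exact: dist.
    by rewrite sumr_const_nat addKn mulr_natr.
  exact: normc_chain (ltW S0) D E B.
(* a finite window sum is continuous in the radius: let s tend to 1 *)
have window n k : S * normc (\sum_(n <= j < n + k) b j) <=
    4 * K * T k + S * (K / (1 - r)) + 8 * eta * k%:R.
  have [->|k0] := eqVneq k 0%N.
    rewrite addn0 big_geq// normc0 !mulr0 addr0 /T big_geq// mulr0 add0r.
    by rewrite mulr_ge0 ?(ltW S0)// divr_ge0// subr_ge0 ltW.
  have kp : (0 : R) < k%:R by rewrite ltr0n lt0n.
  pose w := 1 + S * K * (n + k)%:R.
  have w0 : 0 < w by rewrite ltr_wpDr// !mulr_ge0// ltW.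
  have : \forall s \near 1^'-, 1 - 4 * eta / w < s.
    by apply: nbhs_left_gt; rewrite ltrBlDr ltrDl divr_gt0// mulr_gt0.
  move=> /(filterI near1)/filter_ex[s [[s0 s1 ms ints] sw]].
  have := V_small s n k s0 s1 ms ints.
  have D : normc (\sum_(n <= j < n + k) b j - \sum_(n <= j < n + k) b j * s%:C%C ^+ j)
     <= k%:R * (K * ((n + k)%:R * (1 - s))).
    rewrite -sumrB (le_trans (ler_normc_sum _ _ _))//.
    apply: (@le_trans _ _ (\sum_(n <= j < n + k) K * ((n + k)%:R * (1 - s)))).
      rewrite !big_nat; apply: ler_sum => j /andP[_ jk].
      rewrite -[X in X - _]mulr1 -mulrBr normcM ler_pM ?normc_ge0//.
      rewrite -(rmorphXn (real_complex R)) -(rmorph1 (real_complex R)) -rmorphB.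
      rewrite normc_real ger0_norm; last by rewrite subr_ge0 exprn_ile1// ltW.
      apply: (le_trans (bernoulli_le j (ltW s0) (ltW s1))).
      by rewrite ler_wpM2r ?subr_ge0 ?(ltW s1)// ler_nat ltnW.
    by rewrite sumr_const_nat addKn -[leLHS]mulr_natl.
  have sw' : S * K * (n + k)%:R * (1 - s) <= 4 * eta.
    have : w * (1 - s) <= 4 * eta by rewrite mulrC -ler_pdivlMr//; lra.
    by apply: le_trans; rewrite ler_wpM2r ?subr_ge0 ?(ltW s1)// /w lerDr.
  have h2 : S * (k%:R * (K * ((n + k)%:R * (1 - s)))) <= 4 * eta * k%:R.
    have -> : S * (k%:R * (K * ((n + k)%:R * (1 - s)))) =
      S * K * (n + k)%:R * (1 - s) * k%:R by ring.
    by rewrite ler_wpM2r.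
  have h3 : S * normc (\sum_(n <= j < n + k) b j) <=
     S * normc (\sum_(n <= j < n + k) b j * s%:C%C ^+ j) +
     S * (k%:R * (K * ((n + k)%:R * (1 - s)))).
    rewrite -mulrDr ler_wpM2l ?(ltW S0)//.
    rewrite -[X in normc X <= _](subrK (\sum_(n <= j < n + k) b j * s%:C%C ^+ j)).
    by rewrite addrC (le_trans (ler_normcD _ _))// lerD.
  lra.
have Tk : \forall k \near \oo, 4 * K * (k.+1%:R^-1 * T k.+1) < e * S / 4.
  have h : (fun k => 4 * K * (k.+1%:R^-1 * T k.+1)) @ \oo --> (0 : R).
    by rewrite -[X in _ --> X](mulr0 (4 * K)); exact: cvgMl_tmp.
  by apply: (cvgr_lt 0 h); rewrite divr_gt0 ?mulr_gt0.
have [N1 _ HN1] := Tk.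
pose N2 := Num.truncn (S * (K / (1 - r)) / (e * S / 4)).
exists (maxn N1 N2).+1 => -[//|k] n; rewrite ltnS geq_max => /andP[k1 k2].
have kp : (0 : R) < k.+1%:R by rewrite ltr0n.
have hT : 4 * K * T k.+1 <= e * S / 4 * k.+1%:R.
  have := HN1 k k1; rewrite /= mulrCA mulrC ltr_pdivrMr// => h.
  exact: ltW.
have hK : S * (K / (1 - r)) <= e * S / 4 * k.+1%:R.
  rewrite -ler_pdivrMl ?divr_gt0 ?mulr_gt0// mulrC.
  apply: ltW; apply: (lt_le_trans (truncnS_gt _)).
  by rewrite ler_nat ltnS.
have := window n k.+1; rewrite /eta => h.
rewrite -(ler_pM2l S0); lra.
Unshelve. all: by end_near. Qed.

End window_average.

(** * Shift-invariant means *)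

Section shift.
Context (R : realType).
Implicit Types psi : Linf R.

(** The unit mass at [-1], which is [Negz 0]. *)
Definition delta_fun (k : int) : R[i] := (k == Negz 0)%:R.

Lemma delta_summable :
  summable [set: int] (fun k => (normc (delta_fun k))%:E).
Proof.
rewrite /summable (esumID [set Negz 0])//.
rewrite setTI esum_set1//.
rewrite esum1 ?adde0; last first.
  move=> k [_ /= /eqP]; rewrite /delta_fun => /negbTE ->.
  by rewrite normc0 normr0.
by rewrite ltry.
Qed.

Definition delta_L1 : L1Z R := MkL1Z delta_summable.

Lemma limn_eventually_cst (u : (R[i]^o)^nat) (l : R[i]^o) N :
  (forall n, (N <= n)%N -> u n = l) -> limn u = l.
Proof.
move=> ul; apply/cvg_lim; first exact: norm_hausdorff.
apply: cvg_near_cst; exists N => // n /= Nn; exact: ul.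
Qed.

Lemma sumZ_delta (h : int -> R[i]) :
  sumZ (fun k => delta_fun k * h k) = h (Negz 0).
Proof.
rewrite /sumZ (@limn_eventually_cst _ 0 0); last first.
  by move=> n _; rewrite /series/= big1// => i _; rewrite /delta_fun/= mul0r.
rewrite (@limn_eventually_cst _ (h (Negz 0)) 1) ?add0r// => -[//|n] _.
rewrite /series/= big_nat_recl// big1 ?addr0; last first.
  by move=> i _; rewrite /delta_fun/= mul0r.
by rewrite /delta_fun eqxx mul1r.
Qed.

Definition shiftL psi : Linf R := convL delta_L1 psi.

Lemma shiftLE psi n : shiftL psi n = psi (n + 1).
Proof.
rewrite [LHS](_ : _ = convZ delta_fun psi n)// /convZ sumZ_delta.
by congr (psi _); lia.
Qed.

Lemma iter_shiftLE psi i n : iter i shiftL psi n = psi (n + Posz i).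
Proof.
elim: i n => [|i IH] n; first by rewrite addr0.
by rewrite iterS shiftLE IH; congr (psi _); lia.
Qed.

Lemma Tplus_shift phi psi i : Tplus phi -> phi (iter i shiftL psi) = phi psi.
Proof.
move=> [_ inv _]; elim: i => // i IH; rewrite iterS inv//.
rewrite -[RHS](sumZ_delta (fun=> 1)); congr sumZ.
by apply/funext => k; rewrite mulr1.
Qed.

Definition averageL psi (k : nat) : Linf R :=
  (k%:R : R[i])^-1 *: \sum_(0 <= i < k) iter i shiftL psi.

Lemma averageLE psi k n :
  averageL psi k n = k%:R^-1 * \sum_(0 <= i < k) (psi (n + Posz i) : R[i]).
Proof.
rewrite /averageL [LHS](_ : _ = k%:R^-1 * (\sum_(0 <= i < k) iter i shiftL psi) n)//.
congr (_ * _); elim: k => [|k IH]; first by rewrite !big_geq.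
rewrite !big_nat_recr//= -IH.
rewrite [LHS](_ : _ = (\sum_(0 <= i < k) iter i shiftL psi) n + iter k shiftL psi n)//.
by rewrite iter_shiftLE.
Qed.

Lemma Tplus_average phi psi k : (0 < k)%N -> Tplus phi ->
  phi (averageL psi k) = phi psi.
Proof.
move=> k0 Tphi; rewrite /averageL linearZ/= raddf_sum.
rewrite (eq_bigr (fun=> phi psi)); last by move=> i _; exact: Tplus_shift.
have k1 : (k%:R : R[i]) != 0 by rewrite pnatr_eq0 -lt0n.
rewrite sumr_const_nat subn0 -[phi psi *+ k](mulr_natl (phi psi : R[i])).
exact: (mulKf k1 (phi psi : R[i])).
Qed.

Lemma restrict_bounded psi :
  (fun n : int => if 0 <= n then psi n else 0) \in @bddZ R.
Proof.
have /bddZP[M psiM] := Linf_funP psi; apply/bddZP; exists M => n.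
case: ifP => // _; rewrite normc0.
by apply: le_trans (psiM 0); exact: normc_ge0.
Qed.

Definition restrictL psi : Linf R := MkLinf (restrict_bounded psi).

(** A mean in [Tplus] does not see the negative integers: the two functions
    agree from 0 on, so that their difference tends to 0 at [+oo]. *)
Lemma Tplus_restrict phi psi : Tplus phi -> phi (restrictL psi) = phi psi.
Proof.
move=> [_ _ van]; apply/eqP; rewrite -subr_eq0 -raddfB; apply/eqP/van.
apply: cvg_near_cst; exists 0%N => // n _ /=.
rewrite [LHS](_ : _ = restrictL psi (Posz n) - psi (Posz n))//=.
by rewrite subrr.
Qed.

(** The window averages minus [alpha], cut off on the negative integers, tend to 0
    in norm, while the mean takes the constant value [phi psi - alpha] on them;
    continuity of the mean concludes. *)
Lemma Tplus_uniform_average phi psi (alpha : R[i]) :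
  (forall e : R, 0 < e -> exists k0, forall k n, (k0 <= k)%N ->
    normc (k%:R^-1 * \sum_(0 <= i < k) (psi (Posz n + Posz i) : R[i]) - alpha) <= e) ->
  Tplus phi -> phi psi = alpha.
Proof.
move=> H Tphi.
have [[cphi _ phi1] _ _] := Tphi.
pose h k := restrictL (averageL psi k - alpha *: Linf1 R).
have phih k : (0 < k)%N -> phi (h k) = phi psi - alpha.
  move=> k0; rewrite Tplus_restrict// raddfB/= Tplus_average// linearZ/= phi1.
  by congr (_ - _); exact: mulr1.
have hE k n : h k n = if 0 <= n then
    k%:R^-1 * \sum_(0 <= i < k) (psi (n + Posz i) : R[i]) - alpha else 0.
  rewrite /h/=; case: ifP => // _.
  by rewrite [LHS](_ : _ = averageL psi k n - alpha * 1)// averageLE mulr1.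
have h0 : h @ \oo --> (0 : Linf R).
  apply/cvgrPdist_le => e e0.
  have eE : e = (complex.Re e)%:C%C by rewrite RRe_real// gtr0_real.
  have e0' : 0 < complex.Re e by rewrite eE ltcR in e0.
  have [k0 Hk] := H _ e0'; exists k0 => // k /= k0k.
  rewrite sub0r normrN eE [leLHS](_ : _ = Linf_norm (h k))// lecR.
  apply: ge_sup; first by case: (Linf_has_sup (h k)).
  move=> _ [n _ <-]; rewrite hE; case: n => n /=; first exact: Hk.
  by rewrite expr0n addr0 sqrtr0 ltW.
have := @cvg_comp _ _ _ h phi _ _ _ h0 (cphi 0); rewrite raddf0.
move=> /(cvg_lim (@norm_hausdorff _ _)) lim0.
apply/eqP; rewrite -subr_eq0; apply/eqP; rewrite -[RHS]lim0; apply/esym.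
by apply: (@limn_eventually_cst _ _ 1) => n; exact: phih.
Qed.

End shift.
(** * The Tauberian theorem *)

Section tauberian.
Context (R : realType) (psi : Linf R) (alpha : R[i]).
Hypothesis psi_H1 : H1_boundary (fun z => hatZ psi z - alpha / (1 - z)) 1.

(** The coefficients of [hatZ psi z - alpha / (1 - z)] are [psi j - alpha]. *)
Lemma uniform_average_small (e : R) : 0 < e -> exists k0, forall k n, (k0 <= k)%N ->
  normc (k%:R^-1 * \sum_(0 <= i < k) (psi (Posz n + Posz i) : R[i]) - alpha) <= e.
Proof.
move=> e0; have /bddZP[M psiM] := Linf_funP psi.
pose b (j : nat) : R[i] := psi (Posz j) - alpha.
have bK j : normc (b j) <= M + normc alpha.
  by rewrite (le_trans (normcB _ _))// lerD2r.
have g_tail z J : normc z < 1 ->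
    normc (hatZ psi z - alpha / (1 - z) - \sum_(0 <= j < J) b j * z ^+ j)
    <= (M + normc alpha) * (normc z ^+ J / (1 - normc z)).
  move=> z1.
  have H1 := @power_series_tail_le _ (fun j => psi (Posz j)) M (fun j => psiM j) z J z1.
  have H2 := cauchy_kernel_tail_le alpha J z1.
  under eq_bigr do rewrite mulrBl.
  rewrite sumrB.
  have id (x y p q : R[i]) : x - y - (p - q) = (x - p) - (y - q) by ring.
  rewrite id (le_trans (normcB _ _))// mulrDl; exact: lerD.
have [k0 Hk0] := window_average_small bK g_tail e0 psi_H1.
exists k0.+1 => -[//|k] n; rewrite ltnS => k0k.
have := Hk0 k.+1 n (leqW k0k).
have kn : (k.+1%:R : R[i]) != 0 by rewrite pnatr_eq0.
have -> : \sum_(n <= j < n + k.+1) b j =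
    k.+1%:R * (k.+1%:R^-1 * \sum_(0 <= i < k.+1) (psi (Posz n + Posz i) : R[i]) - alpha).
  rewrite mulrBr mulVKf// -[n in LHS]add0n big_addn addKn /b sumrB.
  congr (_ - _); last by rewrite sumr_const_nat subn0 mulr_natl.
  by apply: eq_bigr => i _; rewrite addnC.
have -> : k.+1%:R = (k.+1%:R : R)%:C%C :> R[i] by rewrite rmorph_nat.
by rewrite normcM normc_real ger0_norm// mulrC ler_pM2r// ltr0n.
Qed.

End tauberian.

Unset Implicit Arguments.

Theorem theorem8p2 (R : realType) (psi : Linf R) (alpha : R[i])
    (psi_neg : forall n : int, n < 0 -> psi n = 0)
    (psi_H1 : H1_boundary (fun z => hatZ psi z - alpha / (1 - z)) 1) :
  onesided_almost_convergent psi alpha /\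
  {uniform, (fun (k n : nat) =>
      k%:R^-1 * \sum_(0 <= i < k) (psi (Posz n + Posz i) : R[i])) @ \oo
    --> (fun=> alpha : R[i]^o)}.
Proof.
have small := uniform_average_small psi_H1.
split; first by move=> phi; exact: Tplus_uniform_average.
move=> P /uniform_nbhs[E [entE subP]].
move: entE; rewrite -entourage_ballE => -[e /= e0 ballE].
have eE : e = (complex.Re e)%:C%C by rewrite RRe_real// gtr0_real.
have e0' : 0 < complex.Re e / 2 by rewrite divr_gt0//; rewrite eE ltcR in e0.
have [k0 Hk] := small _ e0'; exists k0 => // k /= k0k.
apply: subP => n _; apply: ballE => /=.
rewrite -ball_normE /ball_/= distrC normC_normc eE ltcR.
apply: (le_lt_trans (Hk k n k0k)).
by rewrite ltr_pdivrMr// ltr_pMr ?ltr1n//; rewrite eE ltcR in e0.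
Qed.
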